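(* Let $n\ge 2$ and $m_1,\dots,m_h\in\mathbb{N}$. Let $Z_0$ be the flat limit of $h$ collapsing points of multiplicities $m_1,\dots,m_h$ in $\mathbb{A}^n$ along general sections $\sigma_1,\dots,\sigma_h$, and let $Z_1\subset\mathbb{A}^n$ be the union of $h$ general fat points of multiplicities $m_1,\dots,m_h$ (a general member of the degenerating family). Let $$k:=\min\{j\in\mathbb{N}\mid H^0\mathcal{I}_{Z_1,\mathbb{A}^n}(j)\neq 0\},$$ i.e. the smallest $j$ such that there is a nonzero polynomial of degree at most $j$ in the ideal of $Z_1$. Then $\operatorname{mult} Z_0=k$. In particular, the multiplicity of the limit scheme does not depend on the sections $\sigma_i$, as long as they are general.
   Context: We work over $\mathbb{C}$. The fat point of multiplicity $m$ ($m$-tuple point) at $p$ is the scheme defined by the $m$-th power of the ideal of $p$. For a $0$-dimensional scheme $X$ supported at one point $p$, $\operatorname{mult} X$ is the largest $k\in\mathbb{N}$ such that $X$ contains the $k$-tuple point supported at $p$. Collision: let $\Delta$ be a complex disk with $0,1\in\Delta$ ($1$ standing for a general point of $\Delta$), $Y:=\mathbb{A}^n\times\Delta$ with second projection $\pi:Y\to\Delta$ and fibers $Y_t=\mathbb{A}^n\times\{t\}$. Fix $q\in Y_0$ and $h$ general sections $\sigma_1,\dots,\sigma_h:\Delta\to Y$ of $\pi$ with $\sigma_i(0)=q$; generality implies in particular that, on the blow-up of $Y$ at $q$ with exceptional divisor $W\cong\mathbb{P}^n$, the lifted sections meet $W$ in $h$ general points of $W$, and that for general $t$ the points $\sigma_i(t)$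 are in general position. Let $Z:=\bigcup_i\sigma_i(\Delta)^{m_i}\subset Y$, where $\sigma_i(\Delta)^{m_i}$ is the scheme supported on $\sigma_i(\Delta)$ with multiplicity $m_i$ along it, and let $Z_t:=Z_{|Y_t}$. Then $Z_0$ is the flat limit of the $Z_t$, called the flat limit of $h$ collapsing (colliding) points of multiplicities $m_1,\dots,m_h$. $H^0\mathcal{I}_{Z_1,\mathbb{A}^n}(j)$ is identified with the space $L_{n,j}(m_1,\dots,m_h)$ of degree $j$ forms on $\mathbb{P}^n$ with multiplicity at least $m_i$ at $h$ general points. *)

(* Defs.v *)
From HB Require Import structures.
From mathcomp Require Import all_boot all_order all_algebra.
From mathcomp Require Import boolp classical_sets functions topology.
From mathcomp Require Import sequences derive.
(* Not imported: its notations clash with those of mpoly. *)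
From mathcomp Require normed_module.
From mathcomp Require Import mpoly.

Set Implicit Arguments.
Unset Strict Implicit.
Unset Printing Implicit Defensive.

Import Order.TTheory GRing.Theory Num.Theory.
Import normed_module.numFieldNormedType.Exports.

Local Open Scope classical_set_scope.
Local Open Scope ring_scope.

Section FatPoints.
Context (A : comNzRingType).

(* The m-th power of an ideal I: I^0 is the whole ring, and I^(m+1) consists of
   the finite sums of products of an element of I and an element of I^m. *)
Fixpoint ideal_pow (I : set A) (m : nat) : set A :=
  if m is m'.+1 then
    [set f | exists2 s : seq (A * A),
       (forall u, u \in s -> I u.1 /\ ideal_pow I m' u.2) &
       f = \sum_(u <- s) u.1 * u.2]
  else setT.

End FatPoints.

Section AffineSpace.
Context (A : comNzRingType) (n h : nat).

(* Used for two rings A.  If A is the field of complex numbers, this is the ideal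
   of the point a of affine n-space.  If A is the ring of holomorphic functions
   on a disk, then a is a section of (affine n-space) x disk -> disk, {mpoly A[n]}
   consists of the polynomials in x with coefficients holomorphic in t, and this
   is the ideal of the image of the section: p.@[a] = 0 says that p(a(t), t) = 0
   for all t. *)
Definition point_ideal (a : 'rV[A]_n) : set {mpoly A[n]} :=
  [set p | p.@[a 0] = 0].

Definition fat_point_ideal (a : 'rV[A]_n) (m : nat) : set {mpoly A[n]} :=
  ideal_pow (point_ideal a) m.

(* The ideal of the union of the schemes of multiplicity m i along row i a. *)
Definition fat_points_ideal (a : 'M[A]_(h, n)) (m : 'I_h -> nat) :
    set {mpoly A[n]} :=
  \bigcap_(i in [set: 'I_h]) fat_point_ideal (row i a) (m i).

End AffineSpace.

Definition is_min (P : set nat) (k : nat) : Prop :=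
  P k /\ forall j, P j -> (k <= j)%N.

Definition is_max (P : set nat) (k : nat) : Prop :=
  P k /\ forall j, P j -> (j <= k)%N.

Section Geometry.
Context (K : numFieldType) (n : nat).

(* H^0 of the ideal I twisted by j is nonzero.  The sections are the elements of I
   of degree at most j; msize is the degree plus one. *)
Definition has_section (I : set {mpoly K[n]}) (j : nat) : Prop :=
  exists2 f, I f & f != 0 /\ (msize f <= j.+1)%N.

(* mult X = k, where X is the scheme with ideal I, supported at p.  A scheme
   contains the j-tuple point iff its ideal is contained in that of the point. *)
Definition is_mult (I : set {mpoly K[n]}) (p : 'rV[K]_n) (k : nat) : Prop :=
  is_max [set j | I `<=` fat_point_ideal p j] k.

(* The h points are the rows of a.  P holds for general points if it holds on a
   nonempty principal Zariski open subset of the space of all h-tuples. *)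
Definition for_general_points (h : nat) (P : set 'M[K]_(h, n)) : Prop :=
  exists2 G : {mpoly K[h * n]}, G != 0 &
    forall a : 'M[K]_(h, n), G.@[mxvec a 0] != 0 -> P a.

End Geometry.

Section Disk.
Context (K : numFieldType).

(* The parameter 1 stands for a general point of the disk. *)
Record disk := Disk {
  center : K;
  radius : K;
  disk0 : `|0 - center| < radius;
  disk1 : `|1 - center| < radius }.

Context (D : disk).

Definition disk_point := {t : K | `|t - center D| < radius D}.

Definition origin : disk_point := exist _ 0 (disk0 D).

HB.instance Definition _ := Choice.on disk_point.
HB.instance Definition _ := isPointed.Build disk_point origin.

(* Complex analyticity: locally the sum of a convergent power series. *)
Definition holomorphic (f : disk_point -> K) : Prop :=
  forall c : disk_point, exists a : nat -> K, exists2 r : K, 0 < r &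
    forall t : disk_point, `|val t - val c| < r ->
      series (fun k => a k * (val t - val c) ^+ k) @ \oo --> f t.

Definition holomorphic_pred : {pred disk_point -> K} :=
  fun f => `[< holomorphic f >].

Lemma pos_lower_bound (x y : K) : 0 < x -> 0 < y ->
  exists2 z : K, 0 < z & z <= x /\ z <= y.
Proof.
move=> x0 y0; have [xy|/ltW yx] := real_leP (gtr0_real x0) (gtr0_real y0).
  by exists x.
by exists y.
Qed.

Lemma holomorphic_cst (x : K) : holomorphic (fun=> x).
Proof.
move=> c; exists (fun k => if k is 0%N then x else 0), 1 => // t _.
apply: (@cvg_near_cst _ _ _ _ _ eventually_filter).
exists 1%N => // -[//|m] _; rewrite /series/= big_nat_recl//= expr0 mulr1.
by rewrite big1 ?addr0// => i _; rewrite mul0r.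
Qed.

Lemma holomorphicB (f g : disk_point -> K) :
  holomorphic f -> holomorphic g -> holomorphic (f - g).
Proof.
move=> fh gh c; have [a [r r0 fa]] := fh c; have [b [s s0 gb]] := gh c.
have [e e0 [er es]] := pos_lower_bound r0 s0.
exists (fun k => a k - b k), e => // t te.
rewrite (_ : series _ = series (fun k => a k * (val t - val c) ^+ k) -
                        series (fun k => b k * (val t - val c) ^+ k)).
  apply: pseudometric_normed_Zmodule.cvgB.
    exact/fa/(lt_le_trans te).
  exact/gb/(lt_le_trans te).
apply/funext => N; rewrite /series/= -[RHS]sumrB.
by apply: eq_bigr => i _; rewrite mulrBl.
Qed.

Lemma cauchy_product (u v : nat -> K) (N : nat) :
  series (fun k => \sum_(i < k.+1) u i * v (k - i)%N) N =
  \sum_(i < N) \sum_(j < N | (i + j < N)%N) u i * v j.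
Proof.
rewrite /series/= big_mkord.
transitivity (\sum_(k < N) \sum_(i < N | (i < k.+1)%N) u i * v (k - i)%N).
  apply: eq_bigr => k _.
  by apply: (@big_ord_widen _ _ _ k.+1 N (fun i => u i * v (k - i)%N)); exact: ltn_ord.
rewrite (exchange_big_dep xpredT)//=; apply: eq_bigr => i _.
rewrite -(big_mkord (fun k => (i < k.+1)%N) (fun k => u i * v (k - i)%N)).
rewrite -(big_mkord (fun j => (i + j < N)%N) (fun j => u i * v j)).
rewrite (@big_cat_nat _ _ _ i)//=; last exact: ltnW.
rewrite [X in X + _]big_nat_cond big_pred0 ?add0r; last first.
  by move=> k; rewrite leq0n ltnS /= [(i <= k)%N]leqNgt andbN.
rewrite -{1}[val i]add0n big_addn.
rewrite [RHS](@big_cat_nat _ _ _ (N - i))//= ?leq_subr//.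
rewrite [X in _ = _ + X]big_nat_cond [X in _ = _ + X]big_pred0 ?addr0; last first.
  move=> k; rewrite leq_subLR; case: (leqP N (i + k)) => //=.
  by rewrite andbF.
rewrite [LHS]big_nat_cond [RHS]big_nat_cond.
apply: eq_big => [k|k _]; last by rewrite addnK.
rewrite leq0n ltn_subRL ltnS leq_addl /= andbT.
by case: (i + k < N)%N.
Qed.

Lemma cauchy_product_rest (u v : nat -> K) (N : nat) :
  series u N * series v N -
    series (fun k => \sum_(i < k.+1) u i * v (k - i)%N) N =
  \sum_(i < N) \sum_(j < N | ~~ (i + j < N)%N) u i * v j.
Proof.
rewrite cauchy_product /series/= !big_mkord mulr_suml -sumrB.
apply: eq_bigr => i _; rewrite mulr_sumr.
by rewrite [X in X - _](bigID (fun j : 'I_N => (i + j < N)%N))/= addrAC subrr add0r.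
Qed.

Lemma geometric_sum_le (x : K) (N : nat) :
  0 <= x -> x < 1 -> \sum_(i < N) x ^+ i <= (1 - x)^-1.
Proof.
move=> x0 x1; have x1' : 0 < 1 - x by rewrite subr_gt0.
rewrite -[leRHS]mul1r ler_pdivlMr// mulrC -opprB mulNr -subrX1 opprB.
by rewrite lerBlDr lerDl exprn_ge0.
Qed.

Lemma cvg_product (a b : nat -> K) (w z x y : K) : `|z| < w ->
  cvgn (series (fun k => a k * w ^+ k)) ->
  cvgn (series (fun k => b k * w ^+ k)) ->
  series (fun k => a k * z ^+ k) @ \oo --> x ->
  series (fun k => b k * z ^+ k) @ \oo --> y ->
  series (fun k => (\sum_(i < k.+1) a i * b (k - i)%N) * z ^+ k) @ \oo --> x * y.
Proof.
move=> zw aw bw az bz.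
have w0 : 0 < w by exact: le_lt_trans zw.
pose u k := a k * z ^+ k; pose v k := b k * z ^+ k.
have -> : series (fun k => (\sum_(i < k.+1) a i * b (k - i)%N) * z ^+ k) =
   series (fun k => \sum_(i < k.+1) u i * v (k - i)%N).
  congr series; apply/funext => k; rewrite mulr_suml; apply: eq_bigr => i _.
  by rewrite /u /v mulrACA -exprD subnKC// -ltnS.
pose q := `|z| / w.
have q0 : 0 <= q by rewrite divr_ge0// ltW.
have q1 : q < 1 by rewrite ltr_pdivrMr// mul1r.
have uE (c : nat -> K) k : `|c k * z ^+ k| = `|c k * w ^+ k| * q ^+ k.
  rewrite !normrM !normrX (gtr0_norm w0) -mulrA -exprMn; congr (_ * _ ^+ _).
  by rewrite /q mulrCA divff ?mulr1// gt_eqF.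
have a0 := cvg_series_cvg_0 aw; have b0 := cvg_series_cvg_0 bw.
have bnd (c : nat -> K) : c @ \oo --> (0 : K) ->
    exists2 M, 0 < M & forall k, `|c k| <= M.
  move=> c0; have /normed_module.cvg_seq_bounded : cvgn c.
    by apply/cvg_ex; exists 0.
  move=> [M [Mr H]]; exists (`|M| + 1) => [|k]; first by rewrite ltr_wpDl.
  by apply: (H (`|M| + 1)) => //; rewrite (le_lt_trans (real_ler_norm Mr))// ltrDl.
have [M M0 aM] := bnd _ a0; have [M' M'0 bM] := bnd _ b0.
have q10 : 0 < (1 - q)^-1 by rewrite invr_gt0 subr_gt0.
pose L := (M + M') * ((1 - q)^-1 * (1 - q)^-1).
have L0 : 0 < L by rewrite !mulr_gt0// addr_gt0.
rewrite -[x * y]subr0.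
rewrite (_ : series _ = (series u * series v) -
   (series u * series v - series (fun k => \sum_(i < k.+1) u i * v (k - i)%N)));
  last by rewrite subKr.
apply: pseudometric_normed_Zmodule.cvgB; first exact: normed_module.cvgM az bz.
apply/pseudometric_normed_Zmodule.cvgrPdist_le => e e0.
have eL : 0 < e / L by rewrite divr_gt0.
have /pseudometric_normed_Zmodule.cvgrPdist_le/(_ _ eL)[N1 _ H1] := a0.
have /pseudometric_normed_Zmodule.cvgrPdist_le/(_ _ eL)[N2 _ H2] := b0.
exists (N1 + N2)%N => // N /= NN; rewrite sub0r normrN.
rewrite [`|_|](congr1 Num.norm (cauchy_product_rest u v N)).
have E0 : 0 <= e / L * (M + M').
  by apply: mulr_ge0; apply: ltW => //; exact: addr_gt0.
apply: le_trans (_ : e / L * (M + M') *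
   ((\sum_(i < N) q ^+ i) * (\sum_(i < N) q ^+ i)) <= _); last first.
  have eE : e = e / L * (M + M') * ((1 - q)^-1 * (1 - q)^-1).
    by rewrite -mulrA -/L divfK// lt0r_neq0.
  rewrite [leRHS]eE; apply: ler_wpM2l; first exact: E0.
  have S0 : 0 <= \sum_(i < N) q ^+ i by apply: sumr_ge0 => i _; exact: exprn_ge0.
  by apply: ler_pM => //; exact: geometric_sum_le.
rewrite big_distrl/= big_distrr/=; apply: le_trans (ler_norm_sum _ _ _) _.
apply: ler_sum => i _; rewrite big_distrr/= big_distrr/=.
apply: le_trans (ler_norm_sum _ _ _) _.
rewrite [leRHS](bigID (fun j : 'I_N => (i + j < N)%N))/= -[leLHS]add0r lerD//.
  by apply: sumr_ge0 => j _; apply: mulr_ge0 => //; apply: mulr_ge0; exact: exprn_ge0.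
apply: ler_sum => j; rewrite -leqNgt => ij.
rewrite /u /v normrM !uE mulrACA ler_wpM2r ?mulr_ge0 ?exprn_ge0//.
have [iN1|iN1] := leqP N1 i.
  have := H1 _ iN1; rewrite /= sub0r normrN => ai.
  apply: ler_pM => //; apply: le_trans (bM j) _.
  by rewrite lerDr ltW.
have jN2 : (N2 <= j)%N.
  rewrite -(leq_add2l N1); apply: leq_trans NN (leq_trans ij _).
  by rewrite leq_add2r ltnW.
have := H2 _ jN2; rewrite /= sub0r normrN => bj.
rewrite [leRHS]mulrC ler_pM//; apply: le_trans (aM i) _.
by rewrite lerDl ltW.
Qed.

Lemma holomorphicM (f g : disk_point -> K) :
  holomorphic f -> holomorphic g -> holomorphic (f * g).
Proof.
move=> fh gh c; have [a [r r0 fa]] := fh c; have [b [s s0 gb]] := gh c.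
have [e1 e10 [e1r e1s]] := pos_lower_bound r0 s0.
have d0 : 0 < radius D - `|val c - center D| by rewrite subr_gt0; exact: (valP c).
have [e e0 [ee1 ed]] := pos_lower_bound e10 d0.
exists (fun k => \sum_(i < k.+1) a i * b (k - i)%N), e => // t te.
have [w tw we] : exists2 w, `|val t - val c| < w & w < e.
  by exists ((`|val t - val c| + e) / 2%:R); [exact: (midf_lt te).1|exact: (midf_lt te).2].
have w0 : 0 <= w by exact: ltW (le_lt_trans _ tw).
have wD : `|val c + w - center D| < radius D.
  rewrite addrAC; apply: le_lt_trans (ler_normD _ _) _.
  rewrite (ger0_norm w0) -ltrBrDl.
  exact: lt_le_trans we ed.
pose p : disk_point := exist _ (val c + w) wD.
have pw : val p - val c = w by rewrite /= addrC addKr.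
have pe : `|val p - val c| < e1 by rewrite pw ger0_norm// (lt_le_trans we).
have te1 := lt_le_trans te ee1.
apply: (cvg_product tw).
- by rewrite -pw; apply/cvg_ex; exists (f p); exact/fa/(lt_le_trans pe).
- by rewrite -pw; apply/cvg_ex; exists (g p); exact/gb/(lt_le_trans pe).
- exact/fa/(lt_le_trans te1).
- exact/gb/(lt_le_trans te1).
Qed.

Lemma holomorphic_subring : subring_closed holomorphic_pred.
Proof.
split.
- exact/asboolP/holomorphic_cst.
- by move=> f g /asboolP fh /asboolP gh; exact/asboolP/holomorphicB.
- by move=> f g /asboolP fh /asboolP gh; exact/asboolP/holomorphicM.
Qed.

Record hol := Hol {
  hol_fun :> disk_point -> K;
  _ : hol_fun \in holomorphic_pred }.

HB.instance Definition _ := [isSub for hol_fun].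
HB.instance Definition _ := [Choice of hol by <:].
HB.instance Definition _ :=
  GRing.SubChoice_isSubComNzRing.Build _ _ hol holomorphic_subring.

(* The derivative at the origin.  The library's derivative is that of a function
   on the whole field, hence the extension by 0 outside the disk. *)
Definition derivative0 (f : hol) : K :=
  'D_1 (fun t : K => if insub t is Some u then f u else 0) (0 : K).

End Disk.

Section Collision.
Context (K : numFieldType) (D : disk K) (n h : nat).

(* The sections sigma_1, ..., sigma_h are the rows of a matrix of holomorphic
   functions on D. *)
Definition through (q : 'rV[K]_n) (s : 'M[hol D]_(h, n)) : Prop :=
  forall i j, s i j (origin D) = q 0 j.

(* On the blow-up of (affine n-space) x D at (q, 0), with exceptional divisor W a
   projective n-space, the lift of sigma_i meets W at the point with homogeneous
   coordinates [sigma_i'(0) : 1]. *)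
Definition velocity (s : 'M[hol D]_(h, n)) : 'M[K]_(h, n) :=
  map_mx (@derivative0 K D) s.

(* The ideal of the fibre over 0 of the union Z of the sigma_i(D)^(m_i).  A
   function F with t * F in the ideal of Z is itself in the ideal of Z, so Z is
   flat over D and this fibre is the flat limit of the nearby ones. *)
Definition limit_ideal (s : 'M[hol D]_(h, n)) (m : 'I_h -> nat) :
    set {mpoly K[n]} :=
  [set map_mpoly (fun f : hol D => f (origin D)) F | F in fat_points_ideal s m].

(* Generality of sections through q is generality of the points at which their
   lifts meet W.  These lie in the affine chart of W on which the last coordinate
   is nonzero.  Then also the sigma_i(t) are general for small t <> 0, since up to
   the affine map x |-> (x - q) / t they tend to the velocities. *)
Definition for_general_sections (q : 'rV[K]_n) (P : set 'M[hol D]_(h, n)) :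
    Prop :=
  for_general_points (fun v => forall s, through q s -> velocity s = v -> P s).

End Collision.

(* Main.v *)
From HB Require Import structures.
Require Import Defs.
From mathcomp Require Import all_boot all_order all_algebra.
From mathcomp Require Import boolp classical_sets topology.
From mathcomp Require Import sequences derive.
From mathcomp Require normed_module.
From mathcomp Require Import complex reals.
From mathcomp Require Import mpoly fraction ring.

(** Translate [q] to the origin and divide by the parameter: the sections become
    [t tau_i], where the [tau_i] are holomorphic and the [tau_i(0)] are the
    velocities, which are general points. A polynomial [H] with holomorphic
    coefficients vanishes to order [m_i] along the [t tau_i] if and only if
    [H(t x)] does so along the [tau_i] ([fat_points_ideal_dilate]), because [t]
    is not a zero divisor. So the collision at [t = 0] is studied through the
    points [tau_i], which are general at [t = 0].

    Let [k] be the least degree of a nonzero polynomial through the fat points.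

    The multiplicity is at least [k]. Suppose that [H(t x) = t^r G] with [r < k].
    Then [G] lies in the ideal of the fat points along the [tau_i], and at
    [t = 0] it has degree at most [r], since a monomial of larger degree of
    [H(t x)] keeps a power of [t]. By minimality of [k], [G] vanishes at [t = 0],
    hence is divisible by [t]. So [t^k] divides [H(t x)] ([dilate_divisible]),
    and then every coefficient of [H] of degree less than [k] is divisible by
    [t]: the limit of [H] has order at least [k].

    The multiplicity is at most [k]. Take a nonzero polynomial [P] of degree [k]
    through generic fat points, with coefficients polynomial in the coordinates
    of these points. Specialized along the [tau_i] and homogenized by [t], it
    gives an [H] whose limit is the form of degree [k] of [P] at the velocities,
    which is not zero for general velocities.

    Choosing [k] and [P] over the ring of coordinates of generic points makes the
    polynomial family and the minimality uniform. The minimality passes to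
    general points because a matrix without kernel over an integral domain has a
    left inverse up to a nonzero factor ([kernel_or_left_inverse]). The same
    family [P] serves over the complex numbers and over the holomorphic
    functions.

    The analytic input is that a holomorphic function on the disk that vanishes
    at the origin is divisible by the coordinate [t] ([hol_divisible]), that [t]
    is not a zero divisor ([coordinate_reg]), and that the derivative at the
    origin of [x + t g] is [g(0)] ([derivative0_coordinate]). *)

Set Implicit Arguments.
Unset Strict Implicit.
Unset Printing Implicit Defensive.

Import Order.TTheory GRing.Theory Num.Theory.
Import normed_module.numFieldNormedType.Exports.

Local Open Scope classical_set_scope.
Local Open Scope ring_scope.

(** * Translations and dilations of polynomials *)

(** Used to compare two compositions of substitutions and base changes: it
    replaces a computation on coefficients by one on the variables. *)
Lemma mpoly_rmorph_ext (A S : comNzRingType) (n : nat)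
    (f g : {rmorphism {mpoly A[n]} -> S}) :
  (forall c, f c%:MP = g c%:MP) -> (forall i, f 'X_i = g 'X_i) -> f =1 g.
Proof.
move=> fgC fgX; elim/mpolyind => [|c μ p _ _ IH]; first by rewrite !rmorph0.
rewrite !rmorphD -mul_mpolyC !rmorphM fgC IH mpolyXE_id !rmorph_prod.
by congr (_ * _ + _); apply: eq_bigr => i _; rewrite !rmorphXn fgX.
Qed.

(** The coefficients of an image, with the morphism kept as a ring morphism so
    that its multiplicativity can be used on the result. *)
Lemma mcoeff_map_rmorph (A B : comNzRingType) (n : nat) (f : {rmorphism A -> B})
    (p : {mpoly A[n]}) (μ : 'X_{1..n}) : (map_mpoly f p)@_μ = f p@_μ.
Proof. exact: mcoeff_map_mpoly. Qed.

Section Substitutions.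
Context (A : comNzRingType) (n : nat).
Implicit Types (p q : {mpoly A[n]}) (a b : 'rV[A]_n) (t : A) (μ : 'X_{1..n}).

(** [p(x + a)]: its coefficients are the Taylor coefficients of [p] at [a]. *)
Definition shift a p : {mpoly A[n]} :=
  p \mPo [tuple 'X_i + (a 0 i)%:MP | i < n].

HB.instance Definition _ a := GRing.RMorphism.copy (shift a) (shift a).

Lemma shiftC a c : shift a c%:MP = c%:MP.
Proof. exact: comp_mpolyC. Qed.

Lemma shiftX a i : shift a 'X_i = 'X_i + (a 0 i)%:MP.
Proof. by rewrite /shift comp_mpolyXU -tnth_nth tnth_mktuple. Qed.

Lemma shiftZ a c p : shift a (c *: p) = c *: shift a p.
Proof. exact: comp_mpolyZ. Qed.

Lemma shiftD a b p : shift a (shift b p) = shift (b + a) p.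
Proof.
rewrite -[LHS]/((shift a \o shift b) p).
apply: mpoly_rmorph_ext => [c|i] /=; first by rewrite !shiftC.
by rewrite !shiftX rmorphD /= shiftX shiftC mxE mpolyCD addrA addrAC.
Qed.

Lemma shift0 p : shift 0 p = p.
Proof.
rewrite -[RHS]/(idfun p).
apply: mpoly_rmorph_ext => [c|i] /=; first by rewrite !shiftC.
by rewrite shiftX mxE mpolyC0 addr0.
Qed.

Lemma shiftK a p : shift a (shift (- a) p) = p.
Proof. by rewrite shiftD addNr shift0. Qed.

Lemma shiftNK a p : shift (- a) (shift a p) = p.
Proof. by rewrite shiftD addrN shift0. Qed.

Lemma mcoeff0_shift a p : (shift a p)@_0%MM = p.@[a 0].
Proof.
rewrite -[LHS]/((mcoeff 0%MM \o shift a) p).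
apply: mpoly_rmorph_ext => [c|i] /=.
  by rewrite shiftC mevalC mcoeffC eqxx mulr1.
by rewrite shiftX mevalXU mcoeffD mcoeffC eqxx mulr1 mcoeffX mnm1_eq0 add0r.
Qed.

Definition dilate t p : {mpoly A[n]} := p \mPo [tuple t *: 'X_i | i < n].

HB.instance Definition _ t := GRing.RMorphism.copy (dilate t) (dilate t).

Lemma dilateC t c : dilate t c%:MP = c%:MP.
Proof. exact: comp_mpolyC. Qed.

Lemma dilateX t i : dilate t 'X_i = t *: 'X_i.
Proof. by rewrite /dilate comp_mpolyXU -tnth_nth tnth_mktuple. Qed.

Lemma mcoeff_dilate t p μ : (dilate t p)@_μ = t ^+ mdeg μ * p@_μ.
Proof.
elim/mpolyind: p => [|c ν p _ _ IH]; first by rewrite rmorph0 !mcoeff0 mulr0.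
rewrite rmorphD/= !mcoeffD mulrDr IH; congr (_ + _).
rewrite /dilate comp_mpolyZ comp_mpolyX.
have -> : \prod_(i < n) tnth [tuple t *: 'X_i | i < n] i ^+ ν i =
    t ^+ mdeg ν *: 'X_[ν] :> {mpoly A[n]}.
  rewrite mpolyXE_id mdegE -prodrXr -mul_mpolyC rmorph_prod -big_split/=.
  by apply: eq_bigr => i _; rewrite tnth_mktuple -mul_mpolyC exprMn rmorphXn.
rewrite !mcoeffZ mcoeffX; case: eqP => [->|_]; last by rewrite !mulr0.
by rewrite !mulr1 mulrC.
Qed.

Lemma shift_dilate t a p : shift a (dilate t p) = dilate t (shift (t *: a) p).
Proof.
rewrite -[LHS]/((shift a \o dilate t) p) -[RHS]/((dilate t \o shift (t *: a)) p).
apply: mpoly_rmorph_ext => [c|i] /=; first by rewrite !(shiftC, dilateC).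
rewrite dilateX !shiftX shiftZ shiftX rmorphD/= dilateX dilateC mxE.
by rewrite scalerDr -!mul_mpolyC rmorphM.
Qed.

End Substitutions.

Lemma map_mpoly_shift (A B : comNzRingType) (n : nat) (f : {rmorphism A -> B})
    (a : 'rV[A]_n) (p : {mpoly A[n]}) :
  map_mpoly f (shift a p) = shift (map_mx f a) (map_mpoly f p).
Proof.
rewrite -[LHS]/((map_mpoly f \o shift a) p).
rewrite -[RHS]/((shift (map_mx f a) \o map_mpoly f) p).
apply: mpoly_rmorph_ext => [c|i] /=; first by rewrite map_mpolyC !shiftC map_mpolyC.
by rewrite shiftX rmorphD/= !map_mpolyX map_mpolyC shiftX mxE.
Qed.

(** * Fat points through Taylor coefficients *)

Section FatPointIdeals.
Context (A : comNzRingType) (n : nat).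
Implicit Types (p q : {mpoly A[n]}) (a : 'rV[A]_n) (μ : 'X_{1..n}).

Lemma ideal_pow0 (I : set {mpoly A[n]}) m : ideal_pow I m 0.
Proof. by case: m => //= m; exists [::] => //; rewrite big_nil. Qed.

Lemma ideal_powD (I : set {mpoly A[n]}) m p q :
  ideal_pow I m p -> ideal_pow I m q -> ideal_pow I m (p + q).
Proof.
case: m => //= m [s sI ->] [s' s'I ->]; exists (s ++ s').
  by move=> u; rewrite mem_cat => /orP[/sI|/s'I].
by rewrite big_cat.
Qed.

Lemma ideal_powMl a m p q :
  fat_point_ideal a m q -> fat_point_ideal a m (p * q).
Proof.
case: m => //= m [s sI ->]; exists [seq (p * u.1, u.2) | u <- s].
  move=> _ /mapP[u /sI[u1 u2] ->]; split => //=.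
  by rewrite /point_ideal/= mevalM u1 mulr0.
by rewrite big_map mulr_sumr; apply: eq_bigr => u _; rewrite mulrA.
Qed.

Lemma ideal_powS (I : set {mpoly A[n]}) m p q :
  I p -> ideal_pow I m q -> ideal_pow I m.+1 (p * q).
Proof.
by move=> Ip Iq; exists [:: (p, q)]; rewrite ?big_seq1// => u /[!inE] /eqP->.
Qed.

(** A monomial of degree at least [m] in the [x_i - a_i] is a product of [m] of
    them and of a further polynomial. *)
Lemma fat_point_ideal_shiftX a m μ : (m <= mdeg μ)%N ->
  fat_point_ideal a m (shift (- a) 'X_[μ]).
Proof.
elim: m μ => //= m IH μ mμ.
have /existsP[i μi] : [exists i, μ i != 0].
  apply: contraLR mμ; rewrite negb_exists => /forallP z.
  by rewrite mdegE big1// => i _; apply/eqP; have := z i; rewrite negbK.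
have Uμ : (U_(i) <= μ)%MM.
  by apply/mnm_lepP => j; rewrite mnm1E; case: eqP => // <-; rewrite lt0n.
rewrite -(submK Uμ) addmC mpolyXD rmorphM; apply: ideal_powS.
  by rewrite /point_ideal/= shiftX rmorphD/= mevalXU mevalC mxE addrN.
apply: IH; rewrite -ltnS; apply: leq_trans mμ _.
by rewrite -{1}(submK Uμ) mdegD mdeg1 addn1.
Qed.

(** Orders of vanishing add up under products, which gives one implication; for
    the other, the Taylor expansion writes [p] with monomials of degree at least
    [m] in the [x_i - a_i]. Over any ring, membership in the power of the ideal
    is thus a system of linear conditions on the coefficients of [p]. *)
Lemma fat_point_idealP a m p :
  fat_point_ideal a m p <->
  forall μ, (mdeg μ < m)%N -> (shift a p)@_μ = 0.
Proof.
split.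
  elim: m p => //= m IH p [s sI ->] μ μm.
  rewrite rmorph_sum/= raddf_sum big1_seq//= => u /sI[u1 u2].
  rewrite rmorphM mcoeffM big1// => -[k l] /= /eqP μE.
  have [->|k0] := eqVneq (k : 'X_{1..n}) 0%MM.
    by rewrite mcoeff0_shift u1 mul0r.
  rewrite [X in _ * X](IH _ u2) ?mulr0//.
  apply: leq_trans (_ : mdeg (k + l) <= m)%N; last by rewrite -μE -ltnS.
  by rewrite mdegD -add1n leq_add2r lt0n mdeg_eq0.
move=> p0; rewrite -[p](shiftNK a) [X in shift _ X]mpolyE rmorph_sum/=.
rewrite big_seq; apply: (big_ind (fat_point_ideal a m)).
- exact: ideal_pow0.
- by move=> q r; exact: ideal_powD.
- move=> μ; rewrite mcoeff_msupp => μp.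
  rewrite shiftZ -mul_mpolyC; apply/ideal_powMl/fat_point_ideal_shiftX.
  by rewrite leqNgt; apply: contra μp => /p0/eqP.
Qed.

End FatPointIdeals.

Lemma fat_points_idealP (A : comNzRingType) (n h : nat) (m : 'I_h -> nat)
    (a : 'M[A]_(h, n)) (p : {mpoly A[n]}) :
  fat_points_ideal a m p <->
  forall i μ, (mdeg μ < m i)%N -> (shift (row i a) p)@_μ = 0.
Proof.
split=> [pa i|pa i _]; last by apply/fat_point_idealP/pa.
exact/fat_point_idealP/pa.
Qed.

Section FatPointsTransfer.
Context (A : comNzRingType) (n h : nat) (m : 'I_h -> nat).
Implicit Types (p : {mpoly A[n]}) (a : 'M[A]_(h, n)).

Lemma fat_points_ideal_map (B : comNzRingType) (f : {rmorphism A -> B}) a p :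
  fat_points_ideal a m p -> fat_points_ideal (map_mx f a) m (map_mpoly f p).
Proof.
move=> /fat_points_idealP pa; apply/fat_points_idealP => i μ μm.
by rewrite -map_row -map_mpoly_shift mcoeff_map_rmorph pa// rmorph0.
Qed.

Lemma fat_points_ideal_shift (b : 'rV[A]_n) a p :
  fat_points_ideal (\matrix_i (b + row i a)) m p <->
  fat_points_ideal a m (shift b p).
Proof.
split=> /fat_points_idealP pa; apply/fat_points_idealP => i μ μm.
  by rewrite shiftD; have := pa i μ μm; rewrite rowK.
by have := pa i μ μm; rewrite rowK shiftD.
Qed.

(** The Taylor coefficients of [p(t x)] at [a] are those of [p] at [t a]
    multiplied by powers of [t], which can be cancelled. This passes from the
    points [t a_i], which collide at [t = 0], to the points [a_i], which do
    not. *)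
Lemma fat_points_ideal_dilate (t : A) a p : GRing.lreg t ->
  fat_points_ideal (t *: a) m p <-> fat_points_ideal a m (dilate t p).
Proof.
move=> t_reg; split=> /fat_points_idealP pa; apply/fat_points_idealP => i μ μm.
  rewrite shift_dilate mcoeff_dilate; have := pa i μ μm.
  by rewrite linearZ/= => ->; rewrite mulr0.
have := pa i μ μm; rewrite shift_dilate mcoeff_dilate linearZ/=.
by rewrite -[X in _ = X](mulr0 (t ^+ mdeg μ)) => /(lregX t_reg).
Qed.

(** This is the flatness of fat points along sections. *)
Lemma fat_points_idealZ (t : A) a p : GRing.lreg t ->
  fat_points_ideal a m (t *: p) <-> fat_points_ideal a m p.
Proof.
move=> t_reg; split=> /fat_points_idealP pa; apply/fat_points_idealP => i μ μm.
  have := pa i μ μm; rewrite shiftZ mcoeffZ.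
  by rewrite -[X in _ = X](mulr0 t) => /t_reg.
by rewrite shiftZ mcoeffZ pa// mulr0.
Qed.

End FatPointsTransfer.

(** * Linear algebra over an integral domain *)

Section FractionFreeLinearAlgebra.
Context (A : idomainType).

Lemma fraction_denominator (x : {fraction A}) :
  exists2 d : A, d != 0 & exists c, tofrac d * x = tofrac c.
Proof.
elim/quotW: x => x; exists (frac x).2; first exact: denom_ratioP.
exists (frac x).1; unlock tofrac; rewrite -[LHS]FracField.pi_mul.
apply/eqmodP; rewrite /= FracField.equivfE /FracField.mulf.
rewrite !numden_Ratio ?mul1r ?mulr1 ?mulf_neq0 ?oner_neq0 ?denom_ratioP//.
Qed.

Lemma matrix_denominator p q (N : 'M[{fraction A}]_(p, q)) :
  exists2 d : A, d != 0 & exists C : 'M[A]_(p, q),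
    tofrac d *: N = map_mx (@tofrac A) C.
Proof.
have /choice[D DP] : forall u : 'I_p * 'I_q, exists w : A * A,
    w.1 != 0 /\ tofrac w.1 * N u.1 u.2 = tofrac w.2.
  by move=> u; have [d d0 [c dc]] := fraction_denominator (N u.1 u.2); exists (d, c).
exists (\prod_u (D u).1); first by apply/prodf_neq0 => u _; exact: (DP u).1.
exists (\matrix_(i, j) ((D (i, j)).2 * \prod_(u | u != (i, j)) (D u).1)).
apply/matrixP => i j; rewrite !mxE (bigD1 (i, j))//= !rmorphM/=.
by rewrite mulrAC; have /= -> := (DP (i, j)).2.
Qed.

(** Over the field of fractions a matrix without kernel has a left inverse, and
    denominators can be cleared in a kernel vector as well as in a left inverse.
    The second alternative survives every specialization at which [d] is not
    zero. *)
Lemma kernel_or_left_inverse p q (M : 'M[A]_(p, q)) :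
  (exists2 c : 'cV_q, c != 0 & M *m c = 0) \/
  (exists2 d : A, d != 0 & exists N : 'M_(q, p), N *m M = d%:M).
Proof.
pose MF := map_mx (@tofrac A) M.
have inj r s : injective (map_mx (@tofrac A) : 'M_(r, s) -> 'M_(r, s)).
  move=> B C /matrixP BC; apply/matrixP => i j; apply/eqP.
  by rewrite -tofrac_eq; have := BC i j; rewrite !mxE => ->.
have [/row_fullP[B BM]|nfull] := boolP (row_full MF); [right|left].
  have [d d0 [C dC]] := matrix_denominator B; exists d => //; exists C.
  apply: inj; rewrite map_mxM/= -dC -scalemxAl BM scalemx1.
  by rewrite map_scalar_mx.
have /rowV0Pn[w wk w0] : kermx MF^T != 0.
  by rewrite kermx_eq0 -row_leq_rank -ltnNge mxrank_tr ltn_neqAle rank_leq_col andbT.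
have [d d0 [C dC]] := matrix_denominator w; exists C^T.
  apply: contra_neq w0 => C0.
  have := dC; rewrite -[C]trmxK C0 trmx0 map_mx0 => /eqP.
  by rewrite scaler_eq0 tofrac_eq0 (negPf d0) => /eqP.
apply: inj; rewrite map_mxM -map_trmx -dC linearZ/= -scalemxAr.
have /(congr1 trmx) := sub_kermxP wk.
by rewrite trmx_mul trmxK trmx0 => ->; rewrite scaler0 map_mx0.
Qed.

End FractionFreeLinearAlgebra.

(** * Linear conditions imposed by fat points *)

Section VanishingConditions.
Context (n h : nat) (m : 'I_h -> nat).

(** A condition is the vanishing of one Taylor coefficient at one point. The
    common bound on the degrees makes this a product of finite types; the
    superfluous conditions are replaced by zero rows in [condition_mx]. *)
Definition condition := ('I_h * 'X_{1..n < \max_i m i})%type.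

Definition exponent k (j : 'I_#|{: 'X_{1..n < k}}|) : 'X_{1..n} :=
  (enum_val j : 'X_{1..n < k}).

Definition condition_mx (A : comNzRingType) (a : 'M[A]_(h, n)) (k : nat) :
    'M[A]_(#|{: condition}|, #|{: 'X_{1..n < k}}|) :=
  \matrix_(u, j) let: (i, μ) := enum_val u : condition in
    if (mdeg μ < m i)%N then (shift (row i a) 'X_[exponent j])@_μ else 0.

Definition poly_of_col (A : comNzRingType) k
    (c : 'cV[A]_#|{: 'X_{1..n < k}}|) : {mpoly A[n]} :=
  \sum_j c j 0 *: 'X_[exponent j].

Lemma mcoeff_poly_of_col (A : comNzRingType) k
    (c : 'cV[A]_#|{: 'X_{1..n < k}}|) (j : 'I_#|{: 'X_{1..n < k}}|) :
  (poly_of_col c)@_(exponent j) = c j 0.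
Proof.
rewrite raddf_sum/= (bigD1 j)//= mcoeffZ mcoeffX eqxx mulr1 big1 ?addr0// => l lj.
rewrite mcoeffZ mcoeffX; case: eqP => [/val_inj/enum_val_inj lE|]; rewrite ?mulr0//.
by rewrite lE eqxx in lj.
Qed.

Lemma msize_leP (A : comNzRingType) k (p : {mpoly A[n]}) :
  (forall μ, (k <= mdeg μ)%N -> p@_μ = 0) -> (msize p <= k)%N.
Proof.
move=> p0; rewrite msizeE; apply/bigmax_leqP_seq => μ.
rewrite mcoeff_msupp => μp _; rewrite ltnNge; apply: contra μp => /p0 ->.
exact: eqxx.
Qed.

Lemma mcoeff_ge_msize (A : comNzRingType) (p : {mpoly A[n]}) μ :
  (msize p <= mdeg μ)%N -> p@_μ = 0.
Proof. by move=> /msize_mdeg_ge/memN_msupp_eq0. Qed.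

Lemma msize_poly_of_col (A : comNzRingType) k
    (c : 'cV[A]_#|{: 'X_{1..n < k}}|) : (msize (poly_of_col c) <= k)%N.
Proof.
apply: msize_leP => μ kμ; rewrite raddf_sum/= big1// => j _.
rewrite mcoeffZ mcoeffX; case: eqP => [jμ|]; rewrite ?mulr0//.
by have := bmdeg (enum_val j : 'X_{1..n < k}); rewrite -/(exponent j) jμ ltnNge kμ.
Qed.

Lemma poly_of_colK (A : comNzRingType) k (p : {mpoly A[n]}) : (msize p <= k)%N ->
  poly_of_col (\col_j p@_(@exponent k j)) = p.
Proof.
move=> pk; rewrite [RHS](mpolywE pk).
rewrite (reindex _ (onW_bij _ (@enum_val_bij 'X_{1..n < k})))/=.
by apply: eq_bigr => j _; rewrite mxE.
Qed.

Lemma condition_mxP (A : comNzRingType) (a : 'M[A]_(h, n)) k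
    (c : 'cV[A]_#|{: 'X_{1..n < k}}|) :
  condition_mx a k *m c = 0 <-> fat_points_ideal a m (poly_of_col c).
Proof.
have shiftE i μ : (shift (row i a) (poly_of_col c))@_μ =
    \sum_j (shift (row i a) 'X_[exponent j])@_μ * c j 0.
  rewrite rmorph_sum raddf_sum; apply: eq_bigr => j _ /=.
  by rewrite shiftZ mcoeffZ mulrC.
split=> [Mc|/fat_points_idealP ca].
  apply/fat_points_idealP => i μ μm.
  have μN : (mdeg μ < \max_i m i)%N by apply: leq_trans μm (leq_bigmax i).
  have /matrixP/(_ (enum_rank ((i, BMultinom μN) : condition)) 0) := Mc.
  rewrite shiftE !mxE; apply: etrans; apply: eq_bigr => j _.
  by rewrite mxE enum_rankK/= μm.
apply/matrixP => u l; rewrite ord1 !mxE; case E: (enum_val u) => [i μ].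
have [μm|mμ] := boolP (mdeg μ < m i)%N; last first.
  by rewrite big1// => j _; rewrite mxE E (negPf mμ) mul0r.
by apply: etrans (ca i μ μm); rewrite shiftE; apply: eq_bigr => j _; rewrite mxE E μm.
Qed.

Lemma map_condition_mx (A B : comNzRingType) (f : {rmorphism A -> B})
    (a : 'M[A]_(h, n)) k :
  map_mx f (condition_mx a k) = condition_mx (map_mx f a) k.
Proof.
apply/matrixP => u j; rewrite !mxE; case: (enum_val u) => i μ.
case: ifP => _; last by rewrite rmorph0.
by rewrite -map_row -(map_mpolyX f) -map_mpoly_shift mcoeff_map_rmorph.
Qed.

End VanishingConditions.

(** The witness is the product of the [(x_1 - a_(i,1)) ^ m_i]. *)
Lemma fat_points_ideal_neq0 (A : idomainType) (n h : nat) (m : 'I_h -> nat)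
    (a : 'M[A]_(h, n)) : (0 < n)%N ->
  exists2 P, fat_points_ideal a m P & P != 0.
Proof.
move=> n0; pose x := Ordinal n0.
pose L i : {mpoly A[n]} := shift (- row i a) 'X_x.
have L0 i : L i != 0.
  apply/eqP => /(congr1 (shift (row i a))); rewrite shiftK rmorph0.
  move=> /(congr1 (mcoeff U_(x))); rewrite mcoeffX eqxx mcoeff0 => /eqP.
  by rewrite oner_eq0.
exists (\prod_i L i ^+ m i).
  move=> i _; rewrite (bigD1 i)//= mulrC; apply: ideal_powMl.
  have -> : L i ^+ m i = shift (- row i a) 'X_[U_(x) *+ m i].
    by rewrite -mpolyXn rmorphXn.
  by apply: fat_point_ideal_shiftX; rewrite mdegMn mdeg1 mul1n.
by apply/prodf_neq0 => i _; apply: expf_neq0; exact: L0.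
Qed.

(** * Generic points *)

Section GenericPoints.
Context (K : fieldType) (n h : nat) (m : 'I_h -> nat).

Local Notation coordinates := {mpoly K[h * n]}.

Definition generic_points : 'M[coordinates]_(h, n) := vec_mx (\row_j 'X_j).

(** The coordinates of the generic points become those of the rows of [b]; the
    target need not be [K], so that the generic points also specialize to moving
    ones. *)
Definition specialize (B : comNzRingType) (f : {rmorphism K -> B})
  (b : 'M[B]_(h, n)) : coordinates -> B := mmap f (mxvec b 0).

HB.instance Definition _ (B : comNzRingType) (f : {rmorphism K -> B})
  (b : 'M[B]_(h, n)) := GRing.RMorphism.copy (specialize f b) (mmap f (mxvec b 0)).

Lemma specialize_generic_points (B : comNzRingType) (f : {rmorphism K -> B})
    (b : 'M[B]_(h, n)) : map_mx (specialize f b) generic_points = b.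
Proof.
rewrite -[RHS]mxvecK /generic_points map_vec_mx; congr vec_mx; apply/matrixP => i j.
by rewrite !mxE ord1 /specialize mmapX mmap1U.
Qed.

(** If the conditions imposed by the generic points have no kernel in degrees
    less than [k], their matrix has a left inverse up to a factor [d], and then
    so has its specialization at every [v] with [d(v)] nonzero. *)
Lemma generic_to_special_independence (k : nat) :
  (forall P, (msize P <= k)%N -> fat_points_ideal generic_points m P -> P = 0) ->
  exists2 d : coordinates, d != 0 &
    forall v : 'M[K]_(h, n), d.@[mxvec v 0] != 0 ->
    forall f, (msize f <= k)%N -> fat_points_ideal v m f -> f = 0.
Proof.
move=> P0; case: (kernel_or_left_inverse (condition_mx m generic_points k)).
  move=> [c c0 /condition_mxP cg]; case/eqP: c0; apply/matrixP => j l.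
  rewrite ord1 -mcoeff_poly_of_col (P0 _ _ cg) ?msize_poly_of_col//.
  by rewrite mcoeff0 mxE.
move=> [d d0 [N NM]]; exists d => // v dv f fk fv.
rewrite -(poly_of_colK fk) in fv *.
set c := \col_j _ in fv *.
suff -> : c = 0 by rewrite /poly_of_col big1// => j _; rewrite mxE scale0r.
have := congr1 (map_mx (specialize idfun v)) NM.
rewrite map_mxM map_condition_mx specialize_generic_points map_scalar_mx.
move=> /(congr1 (fun X => X *m c)); rewrite -mulmxA.
have /condition_mxP -> := fv; rewrite mulmx0 mul_scalar_mx => /esym/eqP.
by rewrite scaler_eq0 (negPf dv) => /eqP.
Qed.

(** The number [k] is the least degree of a nonzero polynomial through the
    generic fat points, and [P] is one of that degree. Its coefficient of
    exponent [μ], of degree exactly [k], keeps [P] from having smaller degree at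
    all points where it does not vanish. *)
Lemma generic_degree : (0 < n)%N ->
  exists k (P : {mpoly coordinates[n]}) (μ : 'X_{1..n}) (d : coordinates),
  [/\ (msize P <= k.+1)%N, fat_points_ideal generic_points m P,
      mdeg μ = k /\ P@_μ != 0, d != 0 &
      forall v : 'M[K]_(h, n), d.@[mxvec v 0] != 0 ->
      forall f, (msize f <= k)%N -> fat_points_ideal v m f -> f = 0].
Proof.
move=> n0; pose S j := `[< exists2 P, fat_points_ideal generic_points m P &
  P != 0 /\ (msize P <= j.+1)%N >].
have exS : exists j, S j.
  have [P PI P0] := fat_points_ideal_neq0 m generic_points n0.
  by exists (msize P); apply/asboolP; exists P.
case: (ex_minnP exS) => k /asboolP[P PI [P0 Pk]] kmin.
have small f : (msize f <= k)%N -> fat_points_ideal generic_points m f -> f = 0.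
  case: k {P PI P0 Pk} kmin => [_|k kmin fk fI].
    by rewrite leqn0 msize_poly_eq0 => /eqP.
  apply/eqP; apply: contraT => f0.
  suff : (k < k)%N by rewrite ltnn.
  by apply/kmin/asboolP; exists f.
have [μ μk Pμ] : exists2 μ : 'X_{1..n}, mdeg μ = k & P@_μ != 0.
  apply: contrapT => noμ; case/eqP: P0; apply: small => //.
  apply: msize_leP => μ; rewrite leq_eqVlt => /predU1P[kμ|].
    by apply/eqP; apply: contraT => Pμ; case: noμ; exists μ.
  by move=> kμ; apply/mcoeff_ge_msize/(leq_trans Pk).
have [d d0 dP] := generic_to_special_independence small.
by exists k, P, μ, d.
Qed.

End GenericPoints.

(** * Colliding points over a ring with a parameter *)

(** The ring [A] stands for the holomorphic functions on the disk, with
    parameter [t] and evaluation [ev] at the origin. It only matters that [t] is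
    regular and generates the kernel of [ev]. *)
Section Collision.
Context (K : numFieldType) (A : comNzRingType) (ev : {rmorphism A -> K}).
Context (cst : {rmorphism K -> A}) (cstK : cancel cst ev).
Context (t : A) (t_reg : GRing.lreg t) (ev_t : ev t = 0).
Context (ev_ker : forall x, ev x = 0 -> exists y, x = t * y).
Context (n h : nat) (m : 'I_h -> nat) (tau : 'M[A]_(h, n)).

Local Notation v := (map_mx ev tau).

Lemma mpoly_ev_ker (G : {mpoly A[n]}) :
  map_mpoly ev G = 0 -> exists G', G = t *: G'.
Proof.
move=> G0; have /choice[g gE] : forall μ, exists y, G@_μ = t * y.
  by move=> μ; apply: ev_ker; rewrite -mcoeff_map_rmorph G0 mcoeff0.
exists (\sum_(μ <- msupp G) g μ *: 'X_[μ]); rewrite [LHS]mpolyE scaler_sumr.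
by apply: eq_bigr => μ _; rewrite scalerA gE.
Qed.

Section OrderAtLeast.
Context (k : nat) (small : forall f, (msize f <= k)%N ->
  fat_points_ideal v m f -> f = 0).

(** One more power of [t] can be extracted as long as [r < k]. The coefficient
    of [G] of exponent [μ] is that of [H] multiplied by the power of [t] of
    exponent [mdeg μ - r] when [mdeg μ > r], so [G] reduces at [t = 0] to a
    polynomial of degree at most [r] through the fat points at [v]. No such
    polynomial is nonzero, hence [t] divides [G]. *)
Lemma dilate_divisible (H : {mpoly A[n]}) (r : nat) :
  fat_points_ideal tau m (dilate t H) -> (r <= k)%N ->
  exists G, dilate t H = t ^+ r *: G.
Proof.
move=> HI; elim: r => [_|r IH rk]; first by exists (dilate t H); rewrite scale1r.
have [G HG] := IH (ltnW rk).
have GI : fat_points_ideal tau m G.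
  by move: HI; rewrite HG => /fat_points_idealZ; apply; exact: lregX.
have [|G' GE] := @mpoly_ev_ker G.
  apply: small; last exact: fat_points_ideal_map.
  apply: leq_trans (_ : r.+1 <= k)%N => //; apply: msize_leP => μ rμ.
  rewrite mcoeff_map_rmorph.
  have /(congr1 (mcoeff μ)) := HG.
  rewrite mcoeff_dilate mcoeffZ -(subnKC (ltnW rμ)) exprD -mulrA.
  move=> /(lregX t_reg) <-.
  by rewrite rmorphM rmorphXn/= ev_t expr0n subn_eq0 leqNgt rμ mul0r.
by exists G'; rewrite HG GE scalerA exprSr.
Qed.

Lemma order_of_limit (H : {mpoly A[n]}) (μ : 'X_{1..n}) :
  fat_points_ideal tau m (dilate t H) -> (mdeg μ < k)%N -> ev H@_μ = 0.
Proof.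
move=> /dilate_divisible/(_ (leqnn k))[G /(congr1 (mcoeff μ))] HG μk.
move: HG; rewrite mcoeff_dilate mcoeffZ -(subnKC (ltnW μk)) exprD -mulrA.
move=> /(lregX t_reg) ->; rewrite rmorphM rmorphXn/= ev_t expr0n.
by rewrite subn_eq0 leqNgt μk mul0r.
Qed.

End OrderAtLeast.

(** The polynomial [H] is the homogenization of [Q] in [x] and [t]: at [t = 0] it
    is the form of degree [k] of [Q]. *)
Lemma homogenization (Q : {mpoly A[n]}) k : (msize Q <= k.+1)%N ->
  exists H, dilate t H = t ^+ k *: Q.
Proof.
move=> Qk; exists (\sum_(μ <- msupp Q) (Q@_μ * t ^+ (k - mdeg μ)) *: 'X_[μ]).
apply/mpolyP => ν; rewrite mcoeff_dilate mcoeffZ [in RHS](mpolyE Q) !raddf_sum/=.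
rewrite !mulr_sumr !big_seq; apply: eq_bigr => μ μQ.
rewrite !mcoeffZ mcoeffX; case: eqP => [<-|_]; rewrite ?mulr0// !mulr1.
rewrite mulrCA -exprD subnKC 1?mulrC//.
by rewrite -ltnS; apply: leq_trans (msize_mdeg_lt μQ) Qk.
Qed.

(** That every element of the limit ideal has order at least [k] at [q] is
    [order_of_limit]. For the converse, [P] specialized at the points [tau] and
    homogenized gives an element of the ideal of the moving fat points whose
    limit is the form of degree [k] of [P] at the points [v], so has order
    exactly [k]. *)
Theorem multiplicity_of_limit (q : 'rV[K]_n) (k : nat)
    (P : {mpoly {mpoly K[h * n]}[n]}) (μ : 'X_{1..n}) :
  (forall f, (msize f <= k)%N -> fat_points_ideal v m f -> f = 0) ->
  (msize P <= k.+1)%N -> fat_points_ideal (generic_points K n h) m P ->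
  mdeg μ = k -> (P@_μ).@[mxvec v 0] != 0 ->
  is_mult [set map_mpoly ev F | F in
    fat_points_ideal (\matrix_i (map_mx cst q + row i (t *: tau))) m] q k.
Proof.
move=> small Pk PI μk Pμ; have qE : map_mx ev (map_mx cst q) = q.
  by apply/matrixP => i j; rewrite !mxE cstK.
split.
  move=> _ [F /fat_points_ideal_shift/(fat_points_ideal_dilate _ _ _ t_reg) FI <-].
  apply/fat_point_idealP => ν νk; rewrite -qE -map_mpoly_shift mcoeff_map_rmorph.
  exact: order_of_limit FI νk.
move=> j jI; rewrite leqNgt; apply/negP => kj.
pose Q := map_mpoly (specialize cst tau) P.
have [H HE] : exists H, dilate t H = t ^+ k *: Q.
  apply: homogenization; apply: msize_leP => ν kν.
  by rewrite mcoeff_map_rmorph mcoeff_ge_msize ?raddf0// (leq_trans Pk).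
have HI : fat_points_ideal tau m (dilate t H).
  rewrite HE; apply/fat_points_idealZ; first exact: lregX.
  rewrite -(specialize_generic_points cst tau).
  exact: fat_points_ideal_map.
have Hμ : ev H@_μ = (P@_μ).@[mxvec v 0].
  have /(congr1 (mcoeff μ)) := HE; rewrite mcoeff_dilate mcoeffZ μk.
  move=> /(lregX t_reg) ->; rewrite mcoeff_map_rmorph.
  rewrite -[LHS]/((ev \o specialize cst tau) _).
  apply: mpoly_rmorph_ext => [c|i] /=.
    by rewrite /specialize mmapC cstK mevalC.
  rewrite /specialize mmapX mmap1U mevalXU -map_mxvec.
  by rewrite [RHS]mxE.
case/eqP: Pμ; rewrite -Hμ.
have /fat_point_idealP/(_ μ) :
    fat_point_ideal q j (map_mpoly ev (shift (- map_mx cst q) H)).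
  apply: jI; exists (shift (- map_mx cst q) H) => //.
  apply/fat_points_ideal_shift/(fat_points_ideal_dilate _ _ _ t_reg).
  by rewrite shiftK.
rewrite μk => /(_ kj).
by rewrite -{1}qE -map_mpoly_shift shiftK mcoeff_map_rmorph.
Qed.

End Collision.

(** * Power series *)

(** This fails in a field with infinitesimals. *)
Definition geometric_cvg (K : numFieldType) : Prop :=
  forall x : K, `|x| < 1 -> (fun k => x ^+ k) @ \oo --> (0 : K).

Section PowerSeries.
Context (K : numFieldType).

(** Only the terms of positive index are bounded: the partial sums of a series
    contain its constant term from index one on. *)
Lemma cvg_dist_le (u : nat -> K) (l c B : K) :
  u @ \oo --> l -> (forall k, `|u k.+1 - c| <= B) -> `|l - c| <= B.
Proof.
move=> ul uB; have B0 : 0 <= B by exact: le_trans (uB 0%N).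
rewrite real_leNgt ?ger0_real//; apply/negP => Bl.
have e0 : 0 < `|l - c| - B by rewrite subr_gt0.
have /pseudometric_normed_Zmodule.cvgrPdist_lt/(_ _ e0)[N _ NP] := ul.
have := NP N.+1 (leqnSn N); rewrite /= => lu.
have : `|l - c| < `|l - c| - B + B.
  apply: le_lt_trans (ler_distD (u N.+1) _ _) _.
  by apply: ltr_leD => //; exact: uB.
by rewrite subrK ltxx.
Qed.

Lemma cvgn_term_bounded (c : nat -> K) : cvgn (series c) ->
  exists2 M : K, 0 < M & forall k, `|c k| <= M.
Proof.
move=> /cvg_series_cvg_0 c0; have /normed_module.cvg_seq_bounded : cvgn c.
  by apply/cvg_ex; exists 0.
move=> [M [Mr H]]; exists (`|M| + 1) => [|k]; first by rewrite ltr_wpDl.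
by apply: (H (`|M| + 1)) => //; rewrite (le_lt_trans (real_ler_norm Mr))// ltrDl.
Qed.

Lemma power_series0 (a : nat -> K) (l : K) :
  series (fun k => a k * 0 ^+ k) @ \oo --> l -> a 0%N = l.
Proof.
move=> al; apply: (cvg_unique (@pseudometric_normed_Zmodule.norm_hausdorff _ _) _ al).
apply: (@cvg_near_cst _ _ _ _ _ eventually_filter); exists 1%N => // -[//|N] _.
rewrite /series/= big_nat_recl//= mulr1 big1 ?addr0// => i _.
by rewrite expr0n mulr0.
Qed.

(** The terms are bounded at [w], so at [z] the terms after the first are
    dominated by a geometric series of ratio [`|z| / w], at most one half, whose
    first term is a multiple of [`|z|]. *)
Lemma power_series_Lipschitz0 (a : nat -> K) (w : K) : 0 < w ->
  cvgn (series (fun k => a k * w ^+ k)) ->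
  exists2 M : K, 0 < M & forall z l : K, `|z| <= w / 2%:R ->
    series (fun k => a k * z ^+ k) @ \oo --> l -> `|l - a 0%N| <= M * `|z|.
Proof.
move=> w0 /cvgn_term_bounded[M M0 aM].
exists (M / w * 2%:R); first by rewrite !mulr_gt0// ?invr_gt0// ltr0n.
move=> z l zw zl; apply: cvg_dist_le zl _ => N.
rewrite /series/= big_nat_recl//= expr0 mulr1 addrC addKr.
pose x := `|z| / w; have x0 : 0 <= x by rewrite divr_ge0// ltW.
have x2 : x <= 2%:R^-1 by rewrite ler_pdivrMr// mulrC.
have x1 : x < 1 by apply: le_lt_trans x2 _; rewrite invf_lt1 ?ltr0n// ltr1n.
have -> : M / w * 2%:R * `|z| = M * x * 2%:R by rewrite /x; ring.
apply: le_trans (_ : M * x * \sum_(i < N) x ^+ i <= _); last first.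
  apply: ler_wpM2l; first by apply: mulr_ge0 => //; exact: ltW.
  apply: le_trans (geometric_sum_le _ x0 x1) _.
  rewrite -[leRHS]invrK lef_pV2 ?posrE ?subr_gt0 ?invr_gt0 ?ltr0n//.
  rewrite lerBrDr [leRHS](_ : 1 = 2%:R^-1 + 2%:R^-1); last by field.
  by rewrite lerD2l.
rewrite big_mkord mulr_sumr; apply: le_trans (ler_norm_sum _ _ _) _.
apply: ler_sum => i _; rewrite -mulrA -exprS.
have -> : `|a i.+1 * z ^+ i.+1| = `|a i.+1 * w ^+ i.+1| * x ^+ i.+1.
  rewrite !normrM !normrX (gtr0_norm w0) -mulrA -exprMn; congr (_ * _ ^+ _).
  by rewrite /x mulrCA divff ?mulr1// gt_eqF.
by rewrite ler_wpM2r ?exprn_ge0.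
Qed.

Lemma cvg_power_series_inv (c z : K) :
  geometric_cvg K -> c != 0 -> `|z| < `|c| ->
  series (fun k => c^-1 * (- c^-1) ^+ k * z ^+ k) @ \oo --> (c + z)^-1.
Proof.
move=> expr_cvg0 c0 zc; pose x := - (z / c).
have x1 : `|x| < 1 by rewrite normrN normf_div ltr_pdivrMr ?mul1r ?normr_gt0.
have x1' : x != 1 by apply: contraTneq x1 => ->; rewrite normr1 ltxx.
rewrite (_ : series _ = series (geometric c^-1 x)); last first.
  apply/funext => N; apply: eq_bigr => k _; rewrite /geometric/= -mulrA -exprMn.
  by rewrite /x mulNr [c^-1 * z]mulrC.
rewrite geometric_seriesE//.
have -> : (c + z)^-1 = c^-1 * (1 - 0) * (1 - x)^-1.
  by rewrite subr0 mulr1 -invfM /x opprK mulrDr mulr1 mulrCA divff ?mulr1.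
apply: normed_module.cvgMr_tmp; apply: normed_module.cvgMl_tmp.
apply: pseudometric_normed_Zmodule.cvgB; first exact: cvg_cst.
exact: expr_cvg0.
Qed.

End PowerSeries.

(** * Holomorphic functions and division by the coordinate *)

Section HolomorphicDivision.
Context (K : numFieldType) (D : disk K).
Context (expr_cvg0 : geometric_cvg K).

Definition evaluate (s : disk_point D) (f : hol D) : K := f s.

Fact evaluate_is_zmod_morphism s : zmod_morphism (evaluate s).
Proof. by []. Qed.

Fact evaluate_is_monoid_morphism s : monoid_morphism (evaluate s).
Proof. by []. Qed.

HB.instance Definition _ s :=
  GRing.isZmodMorphism.Build (hol D) K (evaluate s) (evaluate_is_zmod_morphism s).
HB.instance Definition _ s :=
  GRing.isMonoidMorphism.Build (hol D) K (evaluate s)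
    (evaluate_is_monoid_morphism s).

Lemma hol_ext (f g : hol D) : (forall s, f s = g s) -> f = g.
Proof. by move=> fg; apply/val_inj/funext. Qed.

Fact constant_holomorphic (x : K) :
  (fun=> x : K) \in holomorphic_pred (D := D).
Proof. exact/asboolP/holomorphic_cst. Qed.

Definition constant (x : K) : hol D := Hol (constant_holomorphic x).

Fact constant_is_zmod_morphism : zmod_morphism constant.
Proof. by move=> x y; exact: hol_ext. Qed.

Fact constant_is_monoid_morphism : monoid_morphism constant.
Proof. by split=> [|x y]; exact: hol_ext. Qed.

HB.instance Definition _ :=
  GRing.isZmodMorphism.Build K (hol D) constant constant_is_zmod_morphism.
HB.instance Definition _ :=
  GRing.isMonoidMorphism.Build K (hol D) constant constant_is_monoid_morphism.

Fact coordinate_holomorphic :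
  (fun s : disk_point D => val s) \in holomorphic_pred (D := D).
Proof.
apply/asboolP => c; exists (fun k => if k is k'.+1 then (k' == 0%N)%:R else val c).
exists 1 => // s _; apply: (@cvg_near_cst _ _ _ _ _ eventually_filter).
exists 2%N => // -[//|[//|N]] _; rewrite /series/= !big_nat_recl//=.
rewrite big1 ?addr0 => [|i _]; last by rewrite mul0r.
by rewrite expr0 expr1 mulr1 mul1r addrC subrK.
Qed.

Definition coordinate : hol D := Hol coordinate_holomorphic.

Lemma disk_translate (c : disk_point D) (w : K) : 0 <= w ->
  w < radius D - `|val c - center D| -> `|val c + w - center D| < radius D.
Proof.
move=> w0 wd; rewrite addrAC; apply: le_lt_trans (ler_normD _ _) _.
by rewrite (ger0_norm w0) -ltrBrDl.
Qed.

Lemma boundary_distance_gt0 (c : disk_point D) : 0 < radius D - `|val c - center D|.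
Proof. by rewrite subr_gt0; exact: (valP c). Qed.

(** Holomorphy at a single point: the inverse of the coordinate has this property
    only away from the origin. *)
Definition expands_at (f : disk_point D -> K) (c : disk_point D) : Prop :=
  exists a : nat -> K, exists2 r : K, 0 < r &
    forall s : disk_point D, `|val s - val c| < r ->
      series (fun k => a k * (val s - val c) ^+ k) @ \oo --> f s.

(** The Cauchy product of the expansion of [f] with the geometric series of the
    inverse of the coordinate. *)
Lemma expands_at_quotient (f : disk_point D -> K) (c : disk_point D) :
  expands_at f c -> val c != 0 -> expands_at (fun s => f s / val s) c.
Proof.
move=> [a [r r0 fa]] c0.
have c0' : 0 < `|val c| by rewrite normr_gt0.
have [e1 e10 [e1r e1c]] := pos_lower_bound r0 c0'.
have [e e0 [ee1 ed]] := pos_lower_bound e10 (boundary_distance_gt0 c).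
pose b k := (val c)^-1 * (- (val c)^-1) ^+ k.
exists (fun k => \sum_(i < k.+1) a i * b (k - i)%N), e => // s se.
(* The Cauchy product needs both series to converge at a point of larger modulus. *)
have [w sw we] : exists2 w, `|val s - val c| < w & w < e.
  exists ((`|val s - val c| + e) / 2%:R).
    exact: (midf_lt se).1.
  exact: (midf_lt se).2.
have w0 : 0 <= w by exact: ltW (le_lt_trans _ sw).
pose p : disk_point D := exist _ (val c + w) (disk_translate w0 (lt_le_trans we ed)).
have pw : val p - val c = w by rewrite /= addrC addKr.
have pe : `|val p - val c| < e1 by rewrite pw ger0_norm// (lt_le_trans we).
have se1 := lt_le_trans se ee1.
apply: (cvg_product sw).
- by rewrite -pw; apply/cvg_ex; exists (f p); exact/fa/(lt_le_trans pe).
- apply/cvg_ex; exists (val c + w)^-1; apply: cvg_power_series_inv => //.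
  by rewrite ger0_norm//; apply: lt_le_trans we (le_trans ee1 e1c).
- exact/fa/(lt_le_trans se1).
- have -> : (val s)^-1 = (val c + (val s - val c))^-1 by rewrite addrC subrK.
  by apply: cvg_power_series_inv => //; exact: lt_le_trans se1 e1c.
Qed.

Lemma expands_at_near (f g : disk_point D -> K) (c : disk_point D) (e : K) :
  0 < e -> (forall s, `|val s - val c| < e -> f s = g s) ->
  expands_at f c -> expands_at g c.
Proof.
move=> e0 fg [a [r r0 fa]]; have [d d0 [dr de]] := pos_lower_bound r0 e0.
exists a, d => // s sd; rewrite -fg; last exact: lt_le_trans sd de.
exact/fa/(lt_le_trans sd).
Qed.

(** The quotient is holomorphic away from the origin by [expands_at_quotient]; at
    the origin the power series of [f] has no constant term and is shifted. *)
Lemma hol_divisible (f : hol D) : f (origin D) = 0 ->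
  exists g, f = coordinate * g.
Proof.
move=> f0; have fh : holomorphic f by exact/asboolP/(valP f).
have [a [r r0 fa]] := fh (origin D).
have a0 : a 0%N = 0.
  rewrite -f0; apply: power_series0.
  by have := fa (origin D); rewrite /= subrr normr0; exact.
pose g s := if val s == 0 then a 1%N else f s / val s.
have gh : g \in holomorphic_pred (D := D).
  apply/asboolP => c; have [c0|c0] := eqVneq (val c) 0; last first.
    apply: (expands_at_near (e := `|val c|)) (expands_at_quotient (fh c) c0).
      by rewrite normr_gt0.
    move=> s sc; rewrite /g; case: eqP => // s0.
    by rewrite s0 sub0r normrN ltxx in sc.
  exists (fun k => a k.+1), r => // s; rewrite c0 subr0 => sr.
  rewrite /g; case: (eqVneq (val s) 0) => s0.
    rewrite s0; apply: (@cvg_near_cst _ _ _ _ _ eventually_filter).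
    exists 1%N => // -[//|N] _; rewrite /series/= big_nat_recl//= mulr1.
    by rewrite big1 ?addr0// => i _; rewrite expr0n mulr0.
  have /fa : `|val s - val (origin D)| < r by rewrite subr0.
  rewrite subr0 -cvg_shiftS => /(normed_module.cvgMr_tmp (b := (val s)^-1)).
  rewrite (_ : (fun=> _) = series (fun k => a k.+1 * val s ^+ k))//.
  apply/funext => N; rewrite /series/= big_nat_recl//= a0 mul0r add0r mulr_suml.
  by apply: eq_bigr => i _; rewrite exprS mulrCA mulrC mulKf.
exists (Hol gh); apply: hol_ext => s; rewrite -[RHS]/(val s * g s) /g.
case: eqP => [s0|/eqP s0]; last by rewrite mulrC divfK.
have -> : s = origin D by exact: val_inj.
by rewrite f0 mul0r.
Qed.

(** This quantitative continuity at the origin determines the value there from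
    the values elsewhere: it gives both the regularity of the coordinate and the
    derivative of a multiple of it. *)
Lemma hol_Lipschitz0 (f : hol D) : exists2 M : K, 0 < M &
  exists2 d : K, 0 < d & forall s : disk_point D, `|val s| <= d ->
    `|f s - f (origin D)| <= M * `|val s|.
Proof.
have fh : holomorphic f by exact/asboolP/(valP f).
have [a [r r0 fa]] := fh (origin D).
have a0 : a 0%N = f (origin D).
  apply: power_series0; have := fa (origin D).
  by rewrite /= subrr normr0; exact.
have [e e0 [er ed]] := pos_lower_bound r0 (boundary_distance_gt0 (origin D)).
have w0 : 0 < e / 2%:R by rewrite divr_gt0// ltr0n.
have we : e / 2%:R < e by rewrite ltr_pdivrMr ?ltr0n// ltr_pMr// ltr1n.
pose p : disk_point D :=
  exist _ (0 + e / 2%:R) (@disk_translate (origin D) _ (ltW w0) (lt_le_trans we ed)).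
have pw : val p - val (origin D) = e / 2%:R by rewrite /= add0r subr0.
have [|M M0 MP] := @power_series_Lipschitz0 _ a _ w0.
  apply/cvg_ex; exists (f p); rewrite -pw; apply: fa.
  by rewrite pw gtr0_norm//; exact: lt_le_trans we er.
exists M => //; exists (e / 2%:R / 2%:R) => [|s sd]; first by rewrite divr_gt0// ltr0n.
rewrite -a0; apply: MP => //.
have /fa : `|val s - val (origin D)| < r.
  rewrite subr0; apply: le_lt_trans sd _; apply: lt_trans (lt_le_trans we er).
  by rewrite ltr_pdivrMr ?ltr0n// ltr_pMr// ltr1n.
by rewrite subr0.
Qed.

Lemma disk_point_near0 (d : K) : 0 < d ->
  exists2 s : disk_point D, val s != 0 & `|val s| <= d.
Proof.
move=> d0; have [e e0 [ed er]] := pos_lower_bound d0 (boundary_distance_gt0 (origin D)).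
have w0 : 0 < e / 2%:R by rewrite divr_gt0// ltr0n.
have we : e / 2%:R < e by rewrite ltr_pdivrMr ?ltr0n// ltr_pMr// ltr1n.
exists (exist _ (0 + e / 2%:R)
  (@disk_translate (origin D) _ (ltW w0) (lt_le_trans we er))).
  by rewrite /= add0r gt_eqF.
by rewrite /= add0r gtr0_norm//; apply: le_trans (ltW we) ed.
Qed.

Lemma coordinate_reg : GRing.lreg coordinate.
Proof.
move=> f g fg.
suff u0 : forall u : hol D, coordinate * u = 0 -> u = 0.
  by apply/eqP; rewrite -subr_eq0; apply/eqP/u0; rewrite mulrBr fg subrr.
move=> {f g fg} u tu.
have us s : val s != 0 -> u s = 0.
  move=> s0; have := congr1 (evaluate s) tu.
  by rewrite rmorphM rmorph0 => /eqP; rewrite mulf_eq0 (negPf s0) => /eqP.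
apply: hol_ext => s; have [s0|/us//] := eqVneq (val s) 0.
have -> : s = origin D by exact: val_inj.
rewrite -[RHS]/(0 : K); apply/eqP; apply: contraT => uN0.
have {uN0} u0 : 0 < `|u (origin D)| by rewrite normr_gt0.
have [M M0 [d d0 uM]] := hol_Lipschitz0 u.
have uM0 : 0 < `|u (origin D)| / (M *+ 2) by rewrite divr_gt0// pmulrn_lgt0.
have [e e0 [ed eu]] := pos_lower_bound d0 uM0.
have [p p0 pe] := disk_point_near0 e0.
have := uM p (le_trans pe ed); rewrite (us _ p0) sub0r normrN.
move=> /le_trans/(_ (ler_wpM2l (ltW M0) (le_trans pe eu))).
have -> : M * (`|u (origin D)| / (M *+ 2)) = `|u (origin D)| / 2%:R.
  by field; rewrite gt_eqF.
by rewrite ler_pdivlMr ?ltr0n// ger_pMr// lern1.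
Qed.

(** Hence the velocity of a section [q + t tau] is the value of [tau] at the
    origin. *)
Lemma derivative0_coordinate (x : K) (g : hol D) :
  derivative0 (constant x + coordinate * g) = g (origin D).
Proof.
rewrite /derivative0 /derive; apply: cvg_lim.
  exact: pseudometric_normed_Zmodule.norm_hausdorff.
have [M M0 [d d0 gM]] := hol_Lipschitz0 g.
apply/pseudometric_normed_Zmodule.cvgrPdist_le => e e0.
have eM : 0 < e / M by rewrite divr_gt0.
have [e1 e10 [e1d e1e]] := pos_lower_bound d0 eM.
have [e2 e20 [e21 e2r]] := pos_lower_bound e10 (boundary_distance_gt0 (origin D)).
near=> z.
have ze2 : `|z| < e2.
  by near: z; exact: pseudometric_normed_Zmodule.dnbhs0_lt.
have z0 : z != 0 by near: z; exact: nbhs_dnbhs_neq.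
have zD : `|z - center D| < radius D.
  have /= := lt_le_trans ze2 e2r; rewrite ltrBrDr sub0r normrN.
  by apply: le_lt_trans; exact: ler_normB.
pose s : disk_point D := exist _ z zD.
rewrite /= addr0 [z *: 1]mulr1.
have -> : insub z = Some s by exact: (valK s).
have -> : insub 0 = Some (origin D).
  by exact: (valK (origin D)).
rewrite (_ : z^-1 *: _ = g s); last first.
  rewrite -[LHS]/(z^-1 * ((x + z * g s) - (x + 0 * g (origin D)))).
  by rewrite mul0r addr0 [x + _]addrC addrK mulKf.
rewrite distrC; have ze1 := ltW (lt_le_trans ze2 e21).
apply: le_trans (gM s (le_trans ze1 e1d)) _.
by rewrite mulrC -ler_pdivlMr//; apply: le_trans ze1 e1e.
Unshelve. all: by end_near. Qed.

End HolomorphicDivision.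

(** * The collision of general fat points *)

Lemma complex_geometric_cvg (R : realType) : geometric_cvg R[i].
Proof.
move=> x x1; have [y xy] : exists y : R, `|x| = y%:C%C.
  by rewrite normc_def; eexists.
have y0 : 0 <= y by rewrite -lecR -xy normr_ge0.
have y1 : `|y| < 1 by rewrite ger0_norm// -ltcR -xy.
apply/pseudometric_normed_Zmodule.cvgrPdist_le => e.
rewrite ltcE => /andP[/eqP e_real e0].
have /pseudometric_normed_Zmodule.cvgrPdist_le/(_ _ e0)[N _ NP] := cvg_expr y1.
exists N => // k /NP; rewrite /= !sub0r !normrN !normrX xy => yk.
rewrite -rmorphXn lecE/= e_real eqxx/=.
by rewrite -(ger0_norm y0).
Qed.

(** The points are general when the generic polynomial of least degree keeps its
    degree and no polynomial of smaller degree appears, that is, when the product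
    of [P@_μ] and [d] does not vanish. Dividing by the coordinate writes the
    sections as [q + t tau], where [tau] specializes at the origin to the
    velocities. *)
Theorem multiplicity_of_collision (K : numFieldType) (n h : nat)
    (m : 'I_h -> nat) : geometric_cvg K -> (0 < n)%N ->
  exists k : nat,
    @for_general_points K n h
      (fun p => is_min (has_section (fat_points_ideal p m)) k) /\
    forall (D : disk K) (q : 'rV[K]_n),
      @for_general_sections K D n h q
        (fun sigma => is_mult (limit_ideal sigma m) q k).
Proof.
move=> geo n0.
have [k [P [μ [d [Pk PI [μk Pμ] d0 small]]]]] :=
  @generic_degree K n h m n0.
have G0 : d * P@_μ != 0 by rewrite mulf_neq0.
exists k; split.
  exists (d * P@_μ) => // v; rewrite mevalM mulf_eq0 negb_or => /andP[dv Pv].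
  split=> [|j [f fI [f0 fj]]].
    exists (map_mpoly (specialize idfun v) P).
      have := fat_points_ideal_map (specialize idfun v) PI.
      by rewrite specialize_generic_points.
    split.
      apply: contra_neq Pv => /(congr1 (mcoeff μ)).
      by rewrite mcoeff_map_rmorph mcoeff0.
    apply: msize_leP => ν kν.
    by rewrite mcoeff_map_rmorph mcoeff_ge_msize ?rmorph0// (leq_trans Pk).
  rewrite leqNgt; apply: contra f0 => jk; apply/eqP.
  by apply: small dv _ (leq_trans fj jk) fI.
move=> D q; exists (d * P@_μ) => // v.
rewrite mevalM mulf_eq0 negb_or => /andP[dv Pv] s sq sv.
pose t := coordinate D; pose ev := evaluate (origin D).
have div := hol_divisible geo (D := D).
have /choice[T TE] : forall u : 'I_h * 'I_n,
    exists g, s u.1 u.2 = constant D (q 0 u.2) + t * g.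
  move=> [i j]; have [|g gE] := div (s i j - constant D (q 0 j)).
    by rewrite -[LHS]/(s i j (origin D) - q 0 j) sq subrr.
  by exists g; rewrite -gE addrC subrK.
pose tau : 'M[hol D]_(h, n) := \matrix_(i, j) T (i, j).
have sE : s = \matrix_i (map_mx (constant D) q + row i (t *: tau)).
  by apply/matrixP => i j; rewrite !mxE; have /= -> := TE (i, j).
have tauv : map_mx ev tau = v.
  rewrite -sv; apply/matrixP => i j; rewrite !mxE; have /= -> := TE (i, j).
  by rewrite derivative0_coordinate.
rewrite sE; apply: (@multiplicity_of_limit K (hol D) ev (constant D) _ t
  (@coordinate_reg K D) _ _ n h m tau q k P μ) => //; rewrite ?tauv//.
exact: small dv.
Qed.

Theorem proposition13 (R : realType) (n h : nat) (hn : (2 <= n)%N)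
    (m : 'I_h -> nat) :
  exists k : nat,
    @for_general_points R[i] n h
      (fun p => is_min (has_section (fat_points_ideal p m)) k) /\
    forall (D : disk R[i]) (q : 'rV[R[i]]_n),
      @for_general_sections R[i] D n h q
        (fun sigma => is_mult (limit_ideal sigma m) q k).
Proof.
exact: multiplicity_of_collision (@complex_geometric_cvg R) (ltnW hn).
Qed.
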